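(* Let $P$ be a poset and let $\mathcal{I}$ be a locally finite collection of intervals in $P$. Then any function $r\colon\mathcal{I}\to\mathbb{Z}$ with upward finite support can uniquely be written as a (possibly infinite, but pointwise finite) $\mathbb{Z}$-linear combination of the functions $\operatorname{Rk}_{\mathcal{I}}\mathbf{k}_I$ with $I\in\mathcal{I}$.
   Context: Fix a field $\mathbf{k}$. An interval in a poset $P$ is a non-empty subset $I$ that is convex ($s\le u\le t$ with $s,t\in I$ implies $u\in I$) and connected (any two elements of $I$ are joined by a finite sequence of elements of $I$ with consecutive ones comparable). $\mathbf{k}_I\colon P\to\mathrm{Vec}_{\mathbf{k}}$ is the representation equal to $\mathbf{k}$ on $I$ and $0$ elsewhere, with identity maps between comparable elements of $I$. For a representation $M\colon P\to\mathrm{Vec}_{\mathbf{k}}$ and an interval $J$, $\operatorname{Rk}_J M=\operatorname{rank}\left[\varprojlim M|_J\to\varinjlim M|_J\right]$ (the canonical map), and $\operatorname{Rk}_{\mathcal{I}}M$ is the function $J\mapsto\operatorname{Rk}_J M$ on $\mathcal{I}$. The collection $\mathcal{I}$ is ordered by inclusion. It is locally finite if for all $I,J\in\mathcal{I}$ the set $\{K\in\mathcal{I}\mid I\subseteq K\subseteq J\}$ is finite. A function $r\colon\mathcal{I}\to\mathbb{Z}$ has upward finite support if for every $I\in\mathcal{I}$ the set $\{J\in\mathcal{I}\mid J\supseteq I,\ r(J)\ne0\}$ is finite. A linear combination $\sum_{I\in\mathcal{I}}\alpha_I\operatorname{Rk}_{\mathcal{I}}\mathbf{k}_I$ with $\alpha_I\in\mathbb{Z}$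 is pointwise finite if for every $J\in\mathcal{I}$ only finitely many $I$ satisfy $\alpha_I\operatorname{Rk}_J\mathbf{k}_I\ne0$. *)

(* Defs.v *)
From HB Require Import structures.
From mathcomp Require Import all_boot all_order all_algebra.
From mathcomp Require Import all_classical.

Set Implicit Arguments.
Unset Strict Implicit.
Unset Printing Implicit Defensive.

Import Order.TTheory GRing.Theory.
Local Open Scope classical_set_scope.
Local Open Scope ring_scope.

Definition dprod (k : fieldType) (T : Type) (V : T -> lmodType k) : Type :=
  forall t, V t.

Section Dprod.
Context (k : fieldType) (T : Type) (V : T -> lmodType k).
Implicit Types f g h : dprod V.

HB.instance Definition _ := gen_eqMixin (dprod V).
HB.instance Definition _ := gen_choiceMixin (dprod V).

Let add f g : dprod V := fun t => f t + g t.
Let opp f : dprod V := fun t => - f t.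
Let zero : dprod V := fun t => 0.
Let scale (a : k) f : dprod V := fun t => a *: f t.

Let addA : associative add.
Proof. by move=> f g h; apply: functional_extensionality_dep => t; apply: addrA. Qed.
Let addC : commutative add.
Proof. by move=> f g; apply: functional_extensionality_dep => t; apply: addrC. Qed.
Let add0 : left_id zero add.
Proof. by move=> f; apply: functional_extensionality_dep => t; apply: add0r. Qed.
Let addN : left_inverse zero opp add.
Proof. by move=> f; apply: functional_extensionality_dep => t; apply: addNr. Qed.
HB.instance Definition _ :=
  GRing.isZmodule.Build (dprod V) addA addC add0 addN.

Let scaleA a b f : scale a (scale b f) = scale (a * b) f.
Proof. by apply: functional_extensionality_dep => t; apply: scalerA. Qed.
Let scale1 : left_id 1 scale.
Proof. by move=> f; apply: functional_extensionality_dep => t; apply: scale1r. Qed.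
Let scaleDr : right_distributive scale +%R.
Proof. by move=> a f g; apply: functional_extensionality_dep => t; apply: scalerDr. Qed.
Let scaleDl f : {morph scale^~ f : a b / a + b}.
Proof. by move=> a b; apply: functional_extensionality_dep => t; apply: scalerDl. Qed.
HB.instance Definition _ := GRing.Zmodule_isLmodule.Build k (dprod V)
  scaleA scale1 scaleDr scaleDl.

Lemma dprodD f g t : (f + g) t = f t + g t. Proof. by []. Qed.
Lemma dprodZ a f t : (a *: f) t = a *: f t. Proof. by []. Qed.
Lemma dprod0 t : (0 : dprod V) t = 0. Proof. by []. Qed.

End Dprod.

Definition submod (k : fieldType) (V : lmodType k) (S : submodClosed V) : Type :=
  {x : V | x \in S}.

Section Submod.
Context (k : fieldType) (V : lmodType k) (S : submodClosed V).
HB.instance Definition _ := SubType.on (submod S).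
HB.instance Definition _ := Choice.on (submod S).
HB.instance Definition _ := [SubChoice_isSubLmodule of submod S by <:].
End Submod.

Lemma submod_zmod_closed (k : fieldType) (V : lmodType k) (S : submodClosed V) :
  zmod_closed S.
Proof. by split=> [|x y xS yS]; rewrite ?rpred0// -scaleN1r rpredD ?rpredZ. Qed.

Definition submod_pred (k : fieldType) (V : lmodType k) (S : submodClosed V) :
  {pred V} := S.
HB.instance Definition _ (k : fieldType) (V : lmodType k) (S : submodClosed V) :=
  GRing.isZmodClosed.Build V (submod_pred S) (submod_zmod_closed S).

Definition quotmod (k : fieldType) (V : lmodType k) (S : submodClosed V) : Type :=
  Quotient.quot (submod_pred S).

Section Quotmod.
Local Open Scope quotient_scope.
Context (k : fieldType) (V : lmodType k) (S : submodClosed V).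
HB.instance Definition _ := Choice.on (quotmod S).
HB.instance Definition _ := GRing.Zmodule.on (quotmod S).

Definition qproj (x : V) : quotmod S := \pi_(Quotient.quot (submod_pred S)) x.

Lemma qprojP x y : qproj x = qproj y <-> x - y \in S.
Proof.
have := Quotient.idealrBE (submod_pred S) x y.
by rewrite -[_ \in submod_pred S]/(x - y \in S) => ->; split=> /eqP.
Qed.

Lemma qproj_surj (u : quotmod S) : exists x, u = qproj x.
Proof. by exists (repr (u : Quotient.quot (submod_pred S))); rewrite /qproj reprK. Qed.

Lemma qprojD x y : qproj (x + y) = qproj x + qproj y.
Proof. by rewrite /qproj !piE. Qed.

Let scale (a : k) (u : quotmod S) : quotmod S :=
  qproj (a *: repr (u : Quotient.quot (submod_pred S))).

Let qprojZ a x : scale a (qproj x) = qproj (a *: x).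
Proof.
by apply/qprojP; rewrite -scalerBr rpredZ//; apply/qprojP; rewrite /qproj reprK.
Qed.

Let scaleA a b u : scale a (scale b u) = scale (a * b) u.
Proof. by have [x ->] := qproj_surj u; rewrite !qprojZ scalerA. Qed.
Let scale1 : left_id 1 scale.
Proof. by move=> u; have [x ->] := qproj_surj u; rewrite qprojZ scale1r. Qed.
Let scaleDr : right_distributive scale +%R.
Proof.
move=> a u v; have [x ->] := qproj_surj u; have [y ->] := qproj_surj v.
by rewrite -qprojD !qprojZ scalerDr qprojD.
Qed.
Let scaleDl u : {morph scale^~ u : a b / a + b}.
Proof.
by move=> a b; have [x ->] := qproj_surj u; rewrite !qprojZ scalerDl qprojD.
Qed.
HB.instance Definition _ := GRing.Zmodule_isLmodule.Build k (quotmod S)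
  scaleA scale1 scaleDr scaleDl.

Lemma qproj_is_linear : linear qproj.
Proof. by move=> a x y; rewrite qprojD -qprojZ. Qed.
HB.instance Definition _ :=
  GRing.isLinear.Build k V (quotmod S) _ qproj qproj_is_linear.

End Quotmod.

Definition span (k : fieldType) (V : lmodType k) (A : set V) : {pred V} :=
  fun x => `[< forall S : {pred V}, submod_closed S ->
                 (forall y, A y -> y \in S) -> x \in S >].

Section Span.
Context (k : fieldType) (V : lmodType k) (A : set V).

Lemma span_submod_closed : submod_closed (span A).
Proof.
split=> [|a x y /asboolP xS /asboolP yS]; apply/asboolP => S Sc AS.
  exact: Sc.1.
by apply: Sc.2; [exact: xS | exact: yS].
Qed.
HB.instance Definition _ :=
  GRing.isSubmodClosed.Build k V (span A) span_submod_closed.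

Lemma mem_span x : A x -> x \in span A.
Proof. by move=> Ax; apply/asboolP => S _; apply. Qed.

End Span.

(* The dimension of a subspace A of W; it is 0 by convention when A is
   infinite-dimensional. *)
Definition dimension (k : fieldType) (W : lmodType k) (A : set W) : nat :=
  xget 0%N [set n | exists w : 'I_n -> W,
    (forall c : 'I_n -> k, \sum_i c i *: w i = 0 -> forall i, c i = 0) /\
    A = [set \sum_i c i *: w i | c in [set: 'I_n -> k]]].

Definition rank (k : fieldType) (V W : lmodType k) (f : {linear V -> W}) : nat :=
  dimension (range f).

Record rep (k : fieldType) d (P : porderType d) := Rep {
  rep_obj :> P -> lmodType k;
  rep_map : forall p q, (p <= q)%O -> {linear rep_obj p -> rep_obj q};
  rep_map_id : forall p (pp : (p <= p)%O) v, rep_map pp v = v;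
  rep_map_comp : forall p q r (pq : (p <= q)%O) (qr : (q <= r)%O)
    (pr : (p <= r)%O) v, rep_map qr (rep_map pq v) = rep_map pr v }.

Definition subposet d (P : porderType d) (A : set P) : Type :=
  {p : P | p \in A}.

Section Subposet.
Context d (P : porderType d) (A : set P).
HB.instance Definition _ := SubType.on (subposet A).
HB.instance Definition _ := Choice.on (subposet A).
HB.instance Definition _ := [SubChoice_isSubPOrder of subposet A by <: with d].
End Subposet.

Definition restrict (k : fieldType) d (P : porderType d) (M : rep k P)
    (A : set P) : rep k (subposet A) :=
  @Rep k d (subposet A) (fun p => M (val p))
    (fun p q (pq : (p <= q)%O) => @rep_map _ _ _ M (val p) (val q) pq)
    (fun p => @rep_map_id _ _ _ M (val p))
    (fun p q r => @rep_map_comp _ _ _ M (val p) (val q) (val r)).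

Section LimColim.
Context (k : fieldType) d (Q : porderType d) (M : rep k Q).

Definition compatible : {pred dprod M} :=
  fun x => `[< forall p q (pq : (p <= q)%O), rep_map M pq (x p) = x q >].

Lemma compatible_submod_closed : submod_closed compatible.
Proof.
split=> [|a x y /asboolP xc /asboolP yc]; apply/asboolP => p q pq.
  by rewrite !dprod0 linear0.
by rewrite !dprodD !dprodZ linearP xc yc.
Qed.
HB.instance Definition _ := GRing.isSubmodClosed.Build k (dprod M) compatible
  compatible_submod_closed.

Definition lim : lmodType k := submod compatible.

Definition finsupp : {pred dprod M} :=
  fun x => `[< finite_set [set p | x p != 0] >].

Lemma finsupp_submod_closed : submod_closed finsupp.
Proof.
split=> [|a x y /asboolP xf /asboolP yf]; apply/asboolP.
  by apply: (sub_finite_set _ (finite_set0 Q)) => p /=; rewrite dprod0 eqxx.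
apply: (sub_finite_set _ (_ : finite_set ([set p | x p != 0] `|`
  [set p | y p != 0]))); last by rewrite finite_setU.
move=> p /=; rewrite dprodD dprodZ.
have [->|xp] := eqVneq (x p) 0; last by left.
by rewrite scaler0 add0r => ?; right.
Qed.
HB.instance Definition _ := GRing.isSubmodClosed.Build k (dprod M) finsupp
  finsupp_submod_closed.

Definition dsum : lmodType k := submod finsupp.

Definition dinj_fun (p : Q) (v : M p) : dprod M := fun q =>
  if @eqP _ p q is ReflectT pq then ecast q (M q) pq v else 0.

Lemma dinj_fun_finsupp p (v : M p) : dinj_fun v \in finsupp.
Proof.
apply/asboolP; apply: (sub_finite_set _ (finite_set1 p)) => q /=.
by rewrite /dinj_fun; case: eqP => [pq _|_]; [rewrite pq|rewrite eqxx].
Qed.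

Definition dinj (p : Q) (v : M p) : dsum := Sub (dinj_fun v) (dinj_fun_finsupp v).

Lemma dinj_is_linear p : linear (@dinj p).
Proof.
move=> a x y; apply/val_inj; apply: functional_extensionality_dep => q /=.
rewrite dprodD dprodZ /dinj_fun; case: eqP => [pq|_].
  by case: q / pq.
by rewrite scaler0 addr0.
Qed.

Definition colim_relations : set dsum :=
  [set x | exists p q (pq : (p <= q)%O) (v : M p),
             x = dinj v - dinj (rep_map M pq v)].

Definition colim : lmodType k := quotmod (span colim_relations).

Definition lim_proj (p : Q) (x : lim) : M p := val x p.

Lemma lim_proj_is_linear p : linear (@lim_proj p).
Proof. by []. Qed.
HB.instance Definition _ p :=
  GRing.isLinear.Build k lim (M p) _ (@lim_proj p) (@lim_proj_is_linear p).

Definition colim_inj (p : Q) (v : M p) : colim := qproj _ (dinj v).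

Lemma colim_inj_is_linear p : linear (@colim_inj p).
Proof. by move=> a x y; rewrite /colim_inj dinj_is_linear linearP. Qed.
HB.instance Definition _ p := GRing.isLinear.Build k (M p) colim _
  (@colim_inj p) (@colim_inj_is_linear p).

(* The canonical map from the limit to the colimit through the index p; when Q
   is connected it does not depend on p, by lim_to_colim_indep. *)
Definition lim_to_colim (p : Q) (x : lim) : colim := colim_inj (lim_proj p x).

Lemma lim_to_colim_is_linear p : linear (lim_to_colim p).
Proof. by move=> a x y; rewrite /lim_to_colim !linearP. Qed.
HB.instance Definition _ p := GRing.isLinear.Build k lim colim _
  (lim_to_colim p) (lim_to_colim_is_linear p).

Lemma lim_projE p q (pq : (p <= q)%O) (x : lim) :
  rep_map M pq (lim_proj p x) = lim_proj q x.
Proof. by have /asboolP := valP x; apply. Qed.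

Lemma colim_injE p q (pq : (p <= q)%O) (v : M p) :
  colim_inj (rep_map M pq v) = colim_inj v.
Proof. by apply/esym/qprojP/mem_span; exists p, q, pq, v. Qed.

Lemma lim_to_colim_indep p s :
  path >=<%O p s -> lim_to_colim (last p s) = lim_to_colim p.
Proof.
elim: s p => //= q s IHs p /andP[pq /IHs ->]; apply: funext => x.
rewrite /lim_to_colim; case/orP: pq => h.
  by rewrite -(lim_projE h) colim_injE.
by rewrite -[in RHS](lim_projE h) colim_injE.
Qed.

End LimColim.

Definition convex_set d (P : porderType d) (I : set P) :=
  forall s t u, I s -> I t -> (s <= u)%O -> (u <= t)%O -> I u.

Definition connected_set d (P : porderType d) (I : set P) :=
  forall s t, I s -> I t -> exists w : seq P,
    [/\ path >=<%O s w, last s w = t & forall u, u \in w -> I u].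

Record poset_interval d (P : porderType d) := PosetInterval {
  carrier :> set P;
  _ : [/\ carrier !=set0, convex_set carrier & connected_set carrier] }.

HB.instance Definition _ d (P : porderType d) := gen_eqMixin (poset_interval P).
HB.instance Definition _ d (P : porderType d) :=
  gen_choiceMixin (poset_interval P).

Section Interval.
Context d (P : porderType d) (I : poset_interval P).

Lemma interval_nonempty : I !=set0. Proof. by case: I => ? []. Qed.
Lemma interval_convex : convex_set I. Proof. by case: I => ? []. Qed.
Lemma interval_connected : connected_set I. Proof. by case: I => ? []. Qed.

Definition interval_point : subposet I :=
  let: exist p Ip := cid interval_nonempty in Sub p (mem_set Ip).

Lemma subposet_connected (p q : subposet I) :
  exists s, path >=<%O p s /\ last p s = q.
Proof.
have [w [pw lw Iw]] := interval_connected (set_mem (valP p)) (set_mem (valP q)).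
elim: w p pw lw Iw => [|u w IHw] p /=.
  by move=> _ /val_inj <- _; exists [::].
move=> /andP[pu uw] lw Iw.
have Iu : u \in carrier I by apply/mem_set/Iw; rewrite mem_head.
have [|s [us ls]] := IHw (Sub u Iu) uw lw.
  by move=> t tw; apply: Iw; rewrite inE tw orbT.
by exists (Sub u Iu :: s); rewrite /= us andbT.
Qed.

End Interval.

(* The choice of interval_point J is immaterial, see RkE. *)
Definition Rk (k : fieldType) d (P : porderType d) (J : poset_interval P)
    (M : rep k P) : nat :=
  rank (lim_to_colim (M := restrict M J) (interval_point J)).

Lemma RkE (k : fieldType) d (P : porderType d) (J : poset_interval P)
    (M : rep k P) (p : subposet J) :
  Rk J M = rank (lim_to_colim (M := restrict M J) p).
Proof.
have [s [ps <-]] := subposet_connected (interval_point J) p.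
by rewrite /Rk /rank /= (lim_to_colim_indep _ ps).
Qed.

Section IntervalRep.
Context (k : fieldType) d (P : porderType d) (I : poset_interval P).

Definition krep_obj (b : bool) : lmodType k := 
  if b then (k^o : lmodType k) else ('rV[k]_0 : lmodType k).

Definition krep_fun (b c : bool) : krep_obj b -> krep_obj c :=
  match b, c return krep_obj b -> krep_obj c with
  | true, true => id
  | _, _ => fun=> 0
  end.

Lemma krep_fun_is_linear b c : linear (@krep_fun b c).
Proof. by case: b c => -[] a x y //=; rewrite scaler0 addr0. Qed.
HB.instance Definition _ b c := GRing.isLinear.Build k (krep_obj b)
  (krep_obj c) _ (@krep_fun b c) (@krep_fun_is_linear b c).

Lemma krep_fun_id b v : @krep_fun b b v = v.
Proof. by case: b v => //= v; rewrite [v]thinmx0. Qed.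

Lemma krep_fun_comp p q r (v : krep_obj (p \in carrier I)) :
  (p <= q)%O -> (q <= r)%O ->
  krep_fun (r \in carrier I) (krep_fun (q \in carrier I) v) =
  krep_fun (r \in carrier I) v.
Proof.
move=> pq qr; have : p \in carrier I -> r \in carrier I -> q \in carrier I.
  by move=> /set_mem Ip /set_mem Ir; apply/mem_set/(interval_convex Ip Ir).
case: (p \in _) v => v; case: (q \in _); case: (r \in _) => //=.
by move=> /(_ isT isT).
Qed.

(* k_I: convexity of I is what makes this functorial. *)
Definition krep : rep k P :=
  @Rep k d P (fun p => krep_obj (p \in carrier I))
    (fun p q _ => @krep_fun (p \in carrier I) (q \in carrier I))
    (fun p _ => @krep_fun_id (p \in carrier I))
    (fun p q r pq qr _ v => krep_fun_comp v pq qr).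

End IntervalRep.

Definition locally_finite d (P : porderType d) (C : set (poset_interval P)) :=
  forall I J, C I -> C J ->
    finite_set [set K | [/\ C K, I `<=` K & K `<=` J]].

Definition upward_finite_support d (P : porderType d)
    (C : set (poset_interval P)) (r : C -> int) :=
  forall I : C, finite_set [set J : C | val I `<=` val J /\ r J != 0].

Definition pointwise_finite (k : fieldType) d (P : porderType d)
    (C : set (poset_interval P)) (a : C -> int) :=
  forall J : C,
    finite_set [set I : C | a I * (Rk (val J) (krep k (val I)))%:Z != 0].

(* Main.v *)
(** If J is contained in I, then k_I restricts to a constant representation on
    the connected poset J and Rk_J k_I = 1; otherwise the canonical map factors
    through (k_I)_p = 0 for some p in J outside I and Rk_J k_I = 0. So the
    matrix of the functions Rk k_I is the zeta function of C ordered by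
    inclusion, and the claim is Moebius inversion for upward finite supports. *)

From HB Require Import structures.
Require Import Defs.
From mathcomp Require Import all_boot all_order all_algebra.
From mathcomp Require Import all_classical.
From mathcomp Require Import finmap.
From Stdlib Require Wf_nat.

Local Open Scope classical_set_scope.
Local Open Scope ring_scope.

Set Implicit Arguments.
Unset Strict Implicit.
Unset Printing Implicit Defensive.

Import GRing.Theory.

(** * Möbius inversion over a partial order, for upward finite supports *)

Section UpwardFinite.
Context (T : choiceType) (le : T -> T -> Prop).
Hypothesis le_refl : forall x, le x x.
Hypothesis le_trans : forall x y z, le x y -> le y z -> le x z.
Hypothesis le_anti : forall x y, le x y -> le y x -> x = y.

Definition upper_in (S : set T) (x : T) : set T := [set y | S y /\ le x y].

(** The arguments are ordered for recursion: [y] counts as a predecessor of [x] when it lies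
    strictly above [x]. *)
Definition above_in (S : set T) (y x : T) : Prop :=
  [/\ S x, S y, le x y & y <> x].

(** Going strictly up from [x] to [y] inside [S] loses [x] from the finite upper set, so its
    cardinality decreases. *)
Lemma wf_above_in (S : set T) :
  (forall x, finite_set (upper_in S x)) -> well_founded (above_in S).
Proof.
move=> fin.
apply: (Wf_nat.well_founded_lt_compat _
  (fun x => #|` fset_set (upper_in S x)|)) => y x [Sx Sy xy ne].
apply/ssrnat.ltP/fproper_ltn_card; rewrite fproperE; apply/andP; split.
  rewrite -fset_set_sub// => z [Sz yz]; split=> //; exact: le_trans yz.
apply/negP; rewrite -fset_set_sub// => /(_ x) [|_ yx]; first by split.
exact/ne/le_anti.
Qed.

Context (A : zmodType).

(** Splits off the diagonal term: the system of upper sums is unitriangular, hence solvable from the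
    top down. *)
Lemma fsbig_upperD1 (S : set T) (x : T) (a : T -> A) :
  (forall x, finite_set (upper_in S x)) -> (forall y, a y != 0 -> S y) -> S x ->
  \sum_(y \in [set y | le x y]) a y =
  a x + \sum_(y \in [set y | above_in S y x]) a y.
Proof.
move=> fin aS Sx; rewrite -(fsbig_widen (upper_in S x)); first last.
- move=> y [/= xy Sy]; apply/eqP/negPn/negP => /aS ?.
  by apply: Sy; split.
- by move=> y [].
rewrite (fsbigD1 x) //; congr (_ + _); apply: eq_fsbigl.
by apply/seteqP; split=> [y [[]]|y []].
Qed.

Lemma upper_sum_inj (a b : T -> A) :
  (forall x, finite_set (upper_in [set y | a y != 0] x)) ->
  (forall x, finite_set (upper_in [set y | b y != 0] x)) ->
  (forall x, \sum_(y \in [set y | le x y]) a y =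
             \sum_(y \in [set y | le x y]) b y) ->
  a = b.
Proof.
(* Both functions vanish off [S]. On [S], induction from above identifies all terms but the diagonal
   one, which is then cancelled. *)
move=> fina finb ab; pose S := [set y | a y != 0] `|` [set y | b y != 0].
have finS x : finite_set (upper_in S x).
  apply: (sub_finite_set _ (_ : finite_set
    (upper_in [set y | a y != 0] x `|` upper_in [set y | b y != 0] x))).
    by move=> y [[?|?] ?]; [left|right].
  by rewrite finite_setU.
apply: funext => x; elim: (wf_above_in finS x) => {}x _ IH.
have [Sx|nSx] := pselect (S x); last first.
  by case/not_orP: nSx => /negP/negPn/eqP -> /negP/negPn/eqP ->.
have := ab x; rewrite !(fsbig_upperD1 finS)//; try by [left|right].
have -> : \sum_(y \in [set y | above_in S y x]) a y =
          \sum_(y \in [set y | above_in S y x]) b y.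
  by apply: eq_fsbigr => y /set_mem; exact: IH.
exact: addIr.
Qed.

(* The solution a is built by recursion on the down-closure S of the support of
   r, which is upward finite because the order is locally finite. *)
Lemma upper_sum_surj (r : T -> A) :
  (forall x y, finite_set [set z | le x z /\ le z y]) ->
  (forall x, finite_set (upper_in [set y | r y != 0] x)) ->
  exists a : T -> A,
    (forall x, finite_set (upper_in [set y | a y != 0] x)) /\
    forall x, r x = \sum_(y \in [set y | le x y]) a y.
Proof.
move=> lfin finr; pose S := [set x | exists2 y, le x y & r y != 0].
have finS x : finite_set (upper_in S x).
  apply: (sub_finite_set _ (bigcup_finite (finr x) (fun y _ => lfin x y))).
  move=> z [[y zy ry] xz]; exists y => //; split=> //; exact: le_trans zy.
(* A call to [rec] needs a proof of [above_in S y x], so the sum ranges over all of [T] with default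
   value 0. *)
pose F x (rec : forall y, above_in S y x -> A) : A :=
  r x - \sum_(y \in [set: T])
    if pselect (above_in S y x) is left h then rec y h else 0.
pose a := Fix (wf_above_in finS) (fun _ => A) F.
have aE x : a x = r x - \sum_(y \in [set y | above_in S y x]) a y.
  rewrite {1}/a Fix_eq => [|{}x f g fg]; congr (_ - _).
    rewrite [RHS]fsbig_mkcond; apply: eq_fsbigr => y _; rewrite /patch.
    by case: pselect => h; [rewrite mem_set|rewrite memNset].
  by apply: eq_fsbigr => y _; case: pselect.
(* Off [S] the correcting sum is empty, so [a y = r y], and this is 0 because [S] contains the
   support of [r]. *)
have aS y : a y != 0 -> S y.
  apply: contraNP => nSy; rewrite aE fsbig1 => [|z [? _ _ _]] //.
  rewrite subr0; apply/negPn/negP => ry; apply: nSy; by exists y.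
exists a; split=> [x|x].
  by apply: (sub_finite_set _ (finS x)) => y [/aS].
have [Sx|nSx] := pselect (S x).
  by rewrite (fsbig_upperD1 finS)// {1}aE subrK.
(* Off [S] both sides vanish: [S] is closed downwards, so no element above [x] lies in [S]. *)
rewrite fsbig1 => [|y /= xy].
  apply/eqP/negPn/negP => rx; apply: nSx; by exists x.
apply/eqP/negPn/negP => /aS[z yz rz]; apply: nSx; exists z => //.
exact: le_trans yz.
Qed.

End UpwardFinite.

(** * Dimension and rank in arbitrary vector spaces *)

(** The coordinates of the [v i] form an m by n matrix; freeness of [v] makes its rows independent,
    so its rank is m. *)
Lemma basis_size_leq (k : fieldType) (W : lmodType k) m n
    (v : 'I_m -> W) (w : 'I_n -> W) :
  (forall c : 'I_m -> k, \sum_i c i *: v i = 0 -> forall i, c i = 0) ->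
  (forall i, exists c : 'I_n -> k, v i = \sum_j c j *: w j) -> (m <= n)%N.
Proof.
move=> vfree /choice[M vM].
have : row_free (\matrix_(i, j) M i j).
  apply: inj_row_free => u uM0; apply/rowP => i; rewrite mxE.
  apply: (vfree (u 0)).
  under eq_bigr do rewrite vM scaler_sumr.
  rewrite exchange_big big1// => j _.
  under eq_bigr do rewrite scalerA.
  rewrite -scaler_suml; have /rowP/(_ j) := uM0; rewrite !mxE.
  by under eq_bigr do rewrite mxE; move=> ->; rewrite scale0r.
by move=> /eqP <-; apply: rank_leq_col.
Qed.

Lemma dimension_basis (k : fieldType) (W : lmodType k) n (w : 'I_n -> W) :
  (forall c : 'I_n -> k, \sum_i c i *: w i = 0 -> forall i, c i = 0) ->
  dimension [set \sum_i c i *: w i | c in [set: 'I_n -> k]] = n.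
Proof.
move=> wfree; apply: xget_unique; first by exists w.
have in_span m (v : 'I_m -> W) i :
    [set \sum_i c i *: v i | c in [set: 'I_m -> k]] (v i).
  exists (fun j => (j == i)%:R) => //; rewrite (bigD1 i)//= eqxx scale1r.
  by rewrite big1 ?addr0// => j /negPf ->; rewrite scale0r.
move=> m [v [vfree wv]]; apply/eqP; rewrite eqn_leq.
apply/andP; split; [apply: (basis_size_leq vfree)|apply: (basis_size_leq wfree)] => i.
  by have := in_span _ v i; rewrite -wv => -[c _ <-]; exists c.
by have := in_span _ w i; rewrite wv => -[c _ <-]; exists c.
Qed.

Lemma rank0 (k : fieldType) (V W : lmodType k) (f : {linear V -> W}) :
  (forall x, f x = 0) -> rank f = 0%N.
Proof.
move=> f0; rewrite /rank -[RHS](@dimension_basis k W 0 (fun=> 0)) => [|? _ []//].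
congr dimension; apply/seteqP; split=> y [x _ <-].
  by exists (fun=> 0); rewrite // big_ord0 f0.
by exists 0; rewrite // big_ord0 f0.
Qed.

Lemma rank1 (k : fieldType) (V W : lmodType k) (f : {linear V -> W}) (x : V) :
  f x != 0 -> (forall y, exists c, f y = c *: f x) -> rank f = 1%N.
Proof.
move=> fx0 fE; rewrite /rank -[RHS](@dimension_basis k W 1 (fun=> f x)).
  congr dimension; apply/seteqP; split=> _ [y _ <-].
    by have [c ->] := fE y; exists (fun=> c); rewrite ?big_ord1.
  by rewrite big_ord1 -linearZ; exists (y ord0 *: x).
move=> c; rewrite big_ord1 => /eqP; rewrite scaler_eq0 (negPf fx0) orbF => /eqP.
by move=> c0 i; rewrite ord1.
Qed.

(** * Maps out of a colimit *)

Lemma fsbig_fset (T : choiceType) (A : nmodType) (S : set T) (F : T -> A) :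
  finite_set S -> (forall x, ~ S x -> F x = 0) ->
  \sum_(x \in [set: T]) F x = \sum_(x <- fset_set S) F x.
Proof.
move=> fS FS; rewrite -fsbig_finite//.
by apply/esym/fsbig_widen => // x [_ /FS].
Qed.

(* A cocone factors through the colimit; only the resulting vanishing statement
   is recorded. *)
Lemma colim_inj_eq0 (k : fieldType) d (Q : porderType d) (M : rep k Q)
    (W : lmodType k) (phi : forall p, {linear M p -> W}) :
  (forall p q (pq : (p <= q)%O) v, phi q (rep_map M pq v) = phi p v) ->
  forall p (v : M p), colim_inj v = 0 -> phi p v = 0.
Proof.
move=> phiE.
(* The map induced by [phi] on the direct sum. For its linearity, all sums are taken over one finite
   set containing both supports. *)
pose total (x : dsum M) := \sum_(q \in [set: Q]) phi q (val x q).
have total_linear : linear total.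
  move=> a x y; have /asboolP fx := valP x; have /asboolP fy := valP y.
  pose S := [set p | val x p != 0] `|` [set p | val y p != 0].
  have fS : finite_set S by rewrite finite_setU.
  have xS p : ~ S p -> val x p = 0 by case/not_orP => /negP/negPn/eqP.
  have yS p : ~ S p -> val y p = 0 by case/not_orP => _ /negP/negPn/eqP.
  have valE p : val (a *: x + y) p = a *: val x p + val y p by [].
  have totalE z : (forall p, ~ S p -> val z p = 0) ->
      total z = \sum_(q <- fset_set S) phi q (val z q).
    by move=> zS; apply: fsbig_fset => // q /zS ->; rewrite linear0.
  rewrite (totalE x xS) (totalE y yS) totalE => [|p Sp]; last first.
    by rewrite valE xS// yS// scaler0 addr0.
  rewrite scaler_sumr -big_split; by apply: eq_bigr => q _; rewrite valE linearP.
have total_dinj p (v : M p) : total (dinj v) = phi p v.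
  rewrite /total -(fsbig_widen [set p])//.
    rewrite fsbig_set1 /= /dinj_fun; case: eqP => // pp.
    by rewrite (eq_irrelevance pp erefl).
  by move=> q [_ /= qp]; rewrite /dinj_fun; case: eqP => [/esym//|]; rewrite linear0.
move=> p v v0; have : qproj (Defs.span (@colim_relations _ _ _ M)) (dinj v) = qproj _ 0.
  by rewrite linear0; exact: v0.
(* The kernel of [total] is a subspace containing the colimit relations, hence contains their
   span. *)
rewrite qprojP subr0 => /asboolP/(_ [pred x | total x == 0]).
rewrite /= inE total_dinj => h; apply/eqP/h.
  split=> [|a x y]; rewrite !inE.
    by have := total_linear (-1) 0 0; rewrite scaler0 addr0 scaleN1r addNr => ->.
  by rewrite total_linear => /eqP -> /eqP ->; rewrite scaler0 addr0.
move=> _ [q [s [qs [u ->]]]]; rewrite inE.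
have := total_linear (-1) (dinj (rep_map M qs u)) (dinj u).
rewrite !scaleN1r !total_dinj phiE addNr addrC => E; exact/eqP/E.
Qed.

(** * Generalized ranks of interval representations *)

Section RkKrep.
Context (k : fieldType) d (P : porderType d).
Implicit Types I J : poset_interval P.

(** Matching on the boolean avoids casts between [krep_obj k b] and [k^o]. *)
Definition krep_one (b : bool) : krep_obj k b :=
  if b return krep_obj k b then (1 : k^o) else 0.

Definition krep_coord (b : bool) : krep_obj k b -> k^o :=
  if b return krep_obj k b -> k^o then id else fun=> 0.

Lemma krep_coord_is_linear b : linear (@krep_coord b).
Proof. by case: b => a x y //=; rewrite scaler0 addr0. Qed.
HB.instance Definition _ b := GRing.isLinear.Build k (krep_obj k b) k^o _
  (@krep_coord b) (@krep_coord_is_linear b).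

Lemma krep_coordK b (v : krep_obj k b) : b -> v = krep_coord v *: krep_one b.
Proof. by case: b v => // v _; rewrite [RHS]mulr1. Qed.

Lemma Rk_krep_sub I J : J `<=` I -> Rk J (krep k I) = 1%N.
Proof.
move=> JI; set M := Defs.restrict (krep k I) J.
have memI (p : subposet J) : val p \in carrier I by apply/mem_set/JI/set_mem/valP.
have one_compatible : (fun p : subposet J => krep_one (val p \in carrier I)) \in
    compatible (M := M).
  by apply/asboolP => p q pq /=; move: (memI p) (memI q); do 2 case: (_ \in _).
pose one : Defs.lim M := exist (fun x => x \in compatible (M := M)) _ one_compatible.
(* The constant section 1 spans the image. It survives in the colimit because the coordinate maps
   form a cocone sending it to 1. *)
apply: (rank1 (x := one)) => [|x].
  apply/eqP => /(colim_inj_eq0 (M := M)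
    (phi := fun p => @krep_coord (val p \in carrier I))) h.
  have /eqP : krep_coord (krep_one (val (interval_point J) \in carrier I)) = 0.
    apply: h => p q pq /=; move: (memI p) (memI q).
    by do 2 case: (_ \in _).
  by rewrite memI oner_eq0.
(* The canonical map reads only the component at [interval_point J], so comparing [x] with a
   multiple of [one] there suffices. *)
exists (krep_coord (lim_proj (interval_point J) x)); rewrite -linearZ.
congr (colim_inj _); rewrite [RHS]linearZ.
by apply: krep_coordK; exact: memI.
Qed.

Lemma Rk_krep_nsub I J : ~ J `<=` I -> Rk J (krep k I) = 0%N.
Proof.
move=> /existsNP[p /not_implyP[Jp nIp]].
pose q : subposet J := Sub p (mem_set Jp).
have M0 (v : Defs.restrict (krep k I) J q) : v = 0.
  by move: v; rewrite /= memNset// => v; exact: thinmx0.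
(* Connectedness of [J] allows the base point to be moved to [q], where the representation is
   zero. *)
rewrite (RkE _ q); apply: rank0 => x.
exact: etrans (congr1 (@colim_inj _ _ _ _ q) (M0 _)) (linear0 _).
Qed.

Lemma Rk_krep I J : Rk J (krep k I) = `[< J `<=` I >] :> nat.
Proof. by case: asboolP => [/Rk_krep_sub|/Rk_krep_nsub]. Qed.

End RkKrep.

(** * Inversion for intervals ordered by inclusion *)

Lemma poset_interval_inj d (P : porderType d) (I J : poset_interval P) :
  carrier I = carrier J -> I = J.
Proof.
case: I J => [I hI] [J hJ] /= IJ; subst J.
by congr PosetInterval; exact: Prop_irrelevance.
Qed.

Theorem mainTheorem2 (k : fieldType) (d : Order.disp_t) (P : porderType d)
    (C : set (poset_interval P)) (hC : locally_finite C)
    (r : C -> int) (hr : upward_finite_support r) :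
  exists! a : C -> int,
    pointwise_finite k a /\
    forall J : C,
      r J = \sum_(I \in [set: C]) a I * (Rk (val J) (krep k (val I)))%:Z.
Proof.
pose le (I J : C) := val I `<=` val J.
have le_refl I : le I I by [].
have le_trans I J K : le I J -> le J K -> le I K by exact: subset_trans.
have le_anti I J : le I J -> le J I -> I = J.
  by move=> IJ JI; apply/val_inj/poset_interval_inj/seteqP.
have le_fin I J : finite_set [set K | le I K /\ le K J].
  have vinj (B : set (poset_interval P)) : {in (val : C -> _) @^-1` B &, injective val}.
    by move=> ? ? _ _; exact: val_inj.
  apply: sub_finite_set (finite_preimage (vinj _) (hC _ _ (set_valP I) (set_valP J))).
  by move=> K [IK KJ]; split=> //; exact: set_valP.
(* Since the rank is 1 or 0 according to whether [J] lies in [I], pointwise finiteness is upward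
   finiteness of the support of [a]. *)
have upper_finP (a : C -> int) :
    pointwise_finite k a <-> forall J, finite_set (upper_in le [set I | a I != 0] J).
  suff E J : [set I | a I * (Rk (val J) (krep k (val I)))%:Z != 0] =
      upper_in le [set I | a I != 0] J.
    by split=> h J; have := h J; rewrite E.
  apply/seteqP; split=> I /=; rewrite Rk_krep mulf_eq0 negb_or.
    by move=> /andP[aI]; case: asboolP.
  by move=> [aI /asboolP ->]; rewrite andbT.
have sumE (a : C -> int) (J : C) :
    \sum_(I \in [set: C]) a I * (Rk (val J) (krep k (val I)))%:Z =
    \sum_(I \in [set I | le J I]) a I.
  rewrite [RHS]fsbig_mkcond; apply: eq_fsbigr => I _; rewrite /patch Rk_krep.
  by rewrite -[_ \in _]/(`[< le J I >]); case: asboolP; rewrite ?mulr1 ?mulr0.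
have [|a [afin aE]] := upper_sum_surj le_refl le_trans le_anti le_fin (r := r).
  by move=> J; apply: sub_finite_set (hr J) => I [].
exists a; split.
  by split=> [|J]; [apply/upper_finP|rewrite sumE].
move=> b [/upper_finP bfin bE].
by apply: (upper_sum_inj le_refl le_trans le_anti) => // J; rewrite -aE -sumE.
Qed.
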